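(* Let $r\geq 1$ and $n\geq 4r^2$ be integers. If $\mathcal{A},\mathcal{B}\subseteq\binom{[n]}{r}$ are cross-intersecting, then $\sigma_r(\mathcal{A})\,\sigma_r(\mathcal{B})\leq r^2\binom{n-2}{r-2}^2$.
   Context: For an $r$-uniform hypergraph $\mathcal{H}\subseteq\binom{[n]}{r}$ (a family of $r$-subsets of $[n]=\{1,\dots,n\}$), $\deg(v)$ is the number of edges containing $v$, $\deg(S)=\sum_{v\in S}\deg(v)$ for an $r$-set $S$, and the Ore-degree $\sigma_r(\mathcal{H})$ is the minimum of $\deg(S)$ over all $r$-subsets $S\subseteq[n]$ with $S\notin\mathcal{H}$. Two families $\mathcal{A},\mathcal{B}$ are cross-intersecting if $A\cap B\neq\emptyset$ for all $A\in\mathcal{A}$, $B\in\mathcal{B}$. *)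

(* Defs.v *)
From HB Require Import structures.
From mathcomp Require Import all_boot all_order all_algebra.
From mathcomp Require Export constructive_ereal.

Set Implicit Arguments.
Unset Strict Implicit.
Unset Printing Implicit Defensive.

Import Order.TTheory GRing.Theory Num.Theory.

Local Open Scope nat_scope.

(* The vertex set [n] = {1, ..., n} is represented by 'I_n = {0, ..., n-1}. *)

Definition uniform (n r : nat) (H : {set {set 'I_n}}) : Prop :=
  forall e : {set 'I_n}, e \in H -> #|e| = r.

Definition vdeg (n : nat) (H : {set {set 'I_n}}) (v : 'I_n) : nat :=
  #|[set e in H | v \in e]|.

Definition sdeg (n : nat) (H : {set {set 'I_n}}) (S : {set 'I_n}) : nat :=
  \sum_(v in S) vdeg H v.

(* The value lives in the extended integers so that the minimum over an empty
   set of non-edges (H consisting of all r-subsets) is +oo; products then obey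
   the library convention 0 * +oo = 0. *)
Definition ore_degree (n r : nat) (H : {set {set 'I_n}}) : \bar int :=
  \big[Order.min/+oo%E]_(S : {set 'I_n} | (#|S| == r) && (S \notin H))
    ((sdeg H S)%:Z%:E)%E.

Definition cross_intersecting (n : nat) (A B : {set {set 'I_n}}) : Prop :=
  forall X Y : {set 'I_n}, X \in A -> Y \in B -> X :&: Y != set0.

(* Binomial coefficient with integer lower index, zero when it is negative;
   truncated subtraction on nat would turn binom(n-2, r-2) into
   binom(n-2, 0) = 1 for r = 1. *)
Definition binz (m : nat) (k : int) : nat :=
  if k is Posz j then 'C(m, j) else 0.

(* Main.v *)
(** Averaging the degree sum over the non-edges gives n * sigma(A) <= r^2 |A|,
    so it suffices to bound |A| |B|. Let s and t be the minimum sizes of a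
    transversal of B and of A. Every member of A meets a minimum transversal of
    A (t choices of a vertex); as long as the chosen vertices number fewer than
    s, some member of B avoids them all, and its r vertices are the choices for
    the next one. Hence |A| <= t r^(s-1) 'C(n-s, r-s), and symmetrically for B.
    For n >= 4 r^2 the product of these bounds is small enough unless
    s = t = 1. In that case either A and B have a common centre x, and any r-set
    avoiding x witnesses sigma <= r 'C(n-2, r-2) for both, or one more branching
    step gives |A|, |B| <= r 'C(n-2, r-2). *)
Require Import Defs.
From mathcomp Require Import all_boot all_order all_algebra.
From mathcomp Require Import zify.

Set Implicit Arguments.
Unset Strict Implicit.
Unset Printing Implicit Defensive.

Import Order.TTheory.

Local Open Scope nat_scope.

(** * Cauchy-Schwarz and binomial estimates *)

Lemma sqr_sum_leq (I : finType) (d : I -> nat) :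
  (\sum_i d i) ^ 2 <= #|I| * \sum_i d i ^ 2.
Proof.
suff: 2 * (\sum_i d i) ^ 2 <= 2 * (#|I| * \sum_i d i ^ 2) by lia.
have -> : 2 * (\sum_i d i) ^ 2 = \sum_i \sum_j 2 * (d i * d j).
  rewrite expnS expn1 big_distrlr big_distrr /=.
  by apply: eq_bigr => i _; rewrite big_distrr.
have -> : 2 * (#|I| * \sum_i d i ^ 2) = \sum_i \sum_j (d i ^ 2 + d j ^ 2).
  under [RHS]eq_bigr => i _ do rewrite big_split sum_nat_const /=.
  by rewrite big_split sum_nat_const -big_distrr /= addnn mul2n.
by apply: leq_sum => i _; apply: leq_sum => j _; apply: nat_Cauchy.
Qed.

(* The number of r-sets containing a given k-set: 'C(n - k, r - k), but 0 when
   k > r, where truncated subtraction would give 1. *)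
Definition nsup (n r k : nat) : nat := if k <= r then 'C(n - k, r - k) else 0.

Lemma binz_nsup n r : 1 <= r -> binz (n - 2) (r%:Z - 2%:Z)%R = nsup n r 2.
Proof. by case: r => [|[|r]]. Qed.

(** This is the absorption identity for binomials; for [k >= r] both sides vanish, thanks to the
    cut-off in [nsup]. *)
Lemma mul_nsup n r k : (n - k) * nsup n r k.+1 = (r - k) * nsup n r k.
Proof.
rewrite /nsup; case: (ltngtP k r) => [lt_kr|_|<-]; last 2 first.
- by rewrite !muln0.
- by rewrite subnn muln0.
by rewrite !subnS mul_bin_diag prednK ?subn_gt0.
Qed.

(* The branching bounds t r^(s-1) 'C(n-s, r-s) and s r^(t-1) 'C(n-t, r-t) have
   the same product as branch n r s and branch n r t. *)
Definition branch (n r k : nat) : nat := k * r ^ k.-1 * nsup n r k.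

(** For [k < r] the ratio of successive values is (k+1) r (r-k) / (k (n-k)), at most 1 because k+1
    <= 2k and n-k >= 2r(r-k). *)
Lemma branchS n r k : 4 * r ^ 2 <= n -> 1 <= k ->
  branch n r k.+1 <= branch n r k.
Proof.
move=> hn k1; rewrite /branch.
have [lt_kr|le_rk] := ltnP k r; last first.
  by rewrite {1}/nsup ltnNge le_rk /= muln0.
have rr : 4 * (r * r) <= n by rewrite mulnn.
have nk : 2 * r * (r - k) <= n - k by nia.
have nk0 : 0 < n - k by nia.
rewrite -(leq_pmul2l nk0) mulnCA mul_nsup -(prednK k1) /= expnS.
set p := r ^ _; set N := nsup _ _ _.
suff: k.-1.+2 * r * (r - k.-1.+1) <= (n - k.-1.+1) * k.-1.+1.
  by move/(leq_mul (leqnn (p * N))); lia.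
rewrite prednK //; apply: (@leq_trans (2 * k * r * (r - k))).
  by rewrite leq_mul2r leq_mul2r; lia.
by have := leq_mul nk (leqnn k); lia.
Qed.

Lemma branch_leq n r k l : 4 * r ^ 2 <= n -> 1 <= k -> k <= l ->
  branch n r l <= branch n r k.
Proof.
move=> hn k1 /subnKC <-; elim: (l - k) => [|d IHd]; first by rewrite addn0.
by rewrite addnS; apply: leq_trans IHd; apply: branchS; lia.
Qed.

(** The worst case, with sizes 1 and 2. For [r >= 2], eliminating [nsup n r 1] by [mul_nsup] leaves
    2 r^3 (n-1) <= (r-1) n^2, which follows from r <= 2(r-1) and 4 r^2 <= n. *)
Lemma branch12 n r : 1 <= r -> 4 * r ^ 2 <= n ->
  r ^ 2 * (branch n r 1 * branch n r 2) <= n ^ 2 * nsup n r 2 ^ 2.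
Proof.
move=> r1 hn; have := mul_nsup n r 1; rewrite /branch /= expn0 expn1.
set D := nsup n r 1; set c := nsup n r 2 => cD.
have [r2|r2] := leqP r 1; first by rewrite /c /nsup ltnNge r2 !muln0.
have r0 : 0 < r - 1 by lia.
rewrite -(leq_pmul2l r0); rewrite -!mulnn in hn *.
have -> : (r - 1) * (r * r * (1 * 1 * D * (2 * r * c))) =
    2 * r * (r * r) * (n - 1) * (c * c).
  by have := congr1 (muln (2 * r * (r * r) * c)) cD; lia.
have : 2 * r * (r * r) * (n - 1) <= (r - 1) * (n * n).
  apply: (@leq_trans (4 * (r * r) * (r - 1) * n)); last first.
    by have := leq_mul hn (leqnn ((r - 1) * n)); lia.
  apply: (@leq_trans (2 * r * (r * r) * n)); first by rewrite leq_mul2l; lia.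
  have : r <= 2 * (r - 1) by lia.
  by move/(leq_mul (leqnn (r * r * n))); lia.
by move/(leq_mul (leqnn (c * c))); lia.
Qed.

Lemma branch_mul_leq n r s t : 1 <= r -> 4 * r ^ 2 <= n ->
  1 <= s -> 1 <= t -> 2 < s + t ->
  r ^ 2 * (branch n r s * branch n r t) <= n ^ 2 * nsup n r 2 ^ 2.
Proof.
move=> r1 hn s1 t1 st; apply: leq_trans (branch12 r1 hn).
rewrite leq_mul2l; apply/orP; right.
have [s2|s2] := leqP s 1.
  by apply: leq_mul; apply: branch_leq; lia.
by rewrite mulnC; apply: leq_mul; apply: branch_leq; lia.
Qed.

Section Hypergraphs.
Variable n : nat.
Implicit Types (A B H F : {set {set 'I_n}}) (G S X Y : {set 'I_n}).

(** * Double counting of degree sums *)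

Lemma sdegE H S : sdeg H S = \sum_(X in H) #|X :&: S|.
Proof.
rewrite /sdeg /vdeg.
under eq_bigr => v _ do rewrite -sum1_card.
under [RHS]eq_bigr => X _ do rewrite -sum1_card.
rewrite (exchange_big_dep (mem H)) /=; last by move=> v X _; rewrite inE => /andP[].
apply: eq_bigr => X XH; apply: eq_bigl => v.
by rewrite !inE XH andbC.
Qed.

Lemma card_leq_sdeg H S :
  (forall X, X \in H -> X :&: S != set0) -> #|H| <= sdeg H S.
Proof.
move=> HS; rewrite sdegE -sum1_card.
by apply: leq_sum => X /HS; rewrite card_gt0.
Qed.

Lemma sum_vdeg H r : uniform r H -> \sum_v vdeg H v = r * #|H|.
Proof.
move=> Hr; have := sdegE H [set: 'I_n]; rewrite /sdeg.
under eq_bigl => v do rewrite inE.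
move=> ->; under eq_bigr => X XH do rewrite setIT (Hr X XH).
by rewrite sum_nat_const mulnC.
Qed.

Lemma sum_sdeg H F : \sum_(S in F) sdeg H S = \sum_v vdeg H v * vdeg F v.
Proof.
rewrite (exchange_big_dep predT) //=; apply: eq_bigr => v _.
rewrite sum_nat_const mulnC; congr (_ * _).
by rewrite /vdeg -sum1_card -[RHS]sum1_card; apply: eq_bigl => X; rewrite !inE.
Qed.

Lemma card_supersets r G :
  #|[set X : {set 'I_n} | (#|X| == r) && (G \subset X)]| <= nsup n r #|G|.
Proof.
rewrite /nsup; case: (leqP #|G| r) => [le_Gr|lt_rG]; last first.
  rewrite leqn0 cards_eq0; apply/eqP/setP => X; rewrite !inE.
  by apply/negbTE/negP => /andP[/eqP Xr /subset_leq_card]; rewrite Xr leqNgt lt_rG.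
have -> : n - #|G| = #|~: G| by rewrite [RHS]cardsCs setCK card_ord.
rewrite -cards_draws -(@card_in_imset _ _ (fun X => X :\: G)).
  apply/subset_leq_card/subsetP => Z /imsetP[X]; rewrite inE => /andP[/eqP Xr sGX] ->.
  by rewrite inE setDE subsetIr /= -setDE cardsD (setIidPr sGX) Xr.
move=> X Y; rewrite !inE => /andP[_ sGX] /andP[_ sGY] eqXY.
by rewrite -(setID X G) -(setID Y G) eqXY (setIidPr sGX) (setIidPr sGY).
Qed.

Lemma vdeg_uniform r H v : uniform r H -> vdeg H v <= nsup n r 1.
Proof.
move=> Hr; rewrite -(cards1 v); apply: leq_trans (card_supersets r [set v]).
apply/subset_leq_card/subsetP => X; rewrite !inE sub1set => /andP[/Hr -> ->].
by rewrite eqxx.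
Qed.

(* Averaging over the non-edges: Cauchy-Schwarz, applied to the degrees on the
   edges, shows that the mean degree sum of a non-edge is at most the mean
   r ^ 2 * #|H| / n over all r-sets. *)
Lemma min_sdeg_leq_card r H a : 1 <= r -> uniform r H ->
    (exists S, (#|S| == r) && (S \notin H)) ->
    (forall S, #|S| = r -> S \notin H -> a <= sdeg H S) ->
  n * a <= r ^ 2 * #|H|.
Proof.
move=> r1 Hr [S0 /andP[/eqP S0r S0H]] Ha.
pose U := [set S : {set 'I_n} | #|S| == r].
have Ur : uniform r U by move=> X; rewrite inE => /eqP.
have sHU : H \subset U by apply/subsetP => X XH; rewrite inE (Hr X XH).
have cU : #|U| = 'C(n, r) by rewrite card_draws card_ord.
have n1 : n * nsup n r 1 = r * #|U|.
  by rewrite /nsup r1 subn1 subn1 mul_bin_diag prednK // cU.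
have cUH : #|U :\: H| = #|U| - #|H| by rewrite cardsD (setIidPr sHU).
have UH0 : 0 < #|U| - #|H|.
  by rewrite -cUH card_gt0; apply/set0Pn; exists S0; rewrite !inE S0H S0r eqxx.
have splitU : \sum_(S in H) sdeg H S + \sum_(S in U :\: H) sdeg H S =
              \sum_(S in U) sdeg H S.
  by rewrite [RHS](big_setID H) /= (setIidPr sHU).
have low : (#|U| - #|H|) * a <= \sum_(S in U :\: H) sdeg H S.
  rewrite -cUH -sum_nat_const; apply: leq_sum => S.
  by rewrite !inE => /andP[SH /eqP Sr]; apply: Ha.
have up : \sum_(S in U) sdeg H S <= r * #|H| * nsup n r 1.
  rewrite sum_sdeg -(sum_vdeg Hr) big_distrl /=.
  by apply: leq_sum => v _; rewrite leq_mul2l (vdeg_uniform v Ur) orbT.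
have cs : (r * #|H|) ^ 2 <= n * \sum_(S in H) sdeg H S.
  rewrite sum_sdeg -(sum_vdeg Hr).
  under [X in n * X]eq_bigr => v _ do rewrite mulnn.
  by have := sqr_sum_leq (vdeg H); rewrite card_ord.
(* Since n * [nsup n r 1] = r |U|, combining [low] and [up], both multiplied by n, with [cs] bounds
   n (|U| - |H|) a by r^2 |H| |U| - r^2 |H|^2, and the factor |U| - |H| cancels. *)
rewrite -(leq_pmul2l UH0).
have := leq_mul (leqnn n) low; have := leq_mul (leqnn n) up.
have -> : n * (r * #|H| * nsup n r 1) = r ^ 2 * #|H| * #|U|.
  by rewrite mulnCA n1 -mulnn; lia.
rewrite -splitU mulnDr.
have -> : (#|U| - #|H|) * (r ^ 2 * #|H|) = r ^ 2 * #|H| * #|U| - (r * #|H|) ^ 2.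
  by rewrite mulnBl expnMn -(mulnn #|H|); lia.
lia.
Qed.

(** * Branching and transversals *)

Lemma branching r m A B G : uniform r A -> uniform r B ->
    cross_intersecting A B ->
    (forall G', G \subset G' -> #|G'| < #|G| + m ->
      exists2 Y, Y \in B & [disjoint Y & G']) ->
  #|[set X in A | G \subset X]| <= r ^ m * nsup n r (#|G| + m).
Proof.
move=> Ar Br AB; elim: m G => [|m IHm] G noT.
  rewrite addn0 expn0 mul1n; apply: leq_trans (card_supersets r G).
  apply/subset_leq_card/subsetP => X; rewrite !inE => /andP[/Ar -> ->].
  by rewrite eqxx.
(* Some [Y] in [B] misses [G], while every member of [A] containing [G] meets [Y]: it contains [G]
   and one of the [r] vertices of [Y], and the induction hypothesis applies to each enlarged set. *)
have [|Y YB dYG] := noT G (subxx _); first by rewrite addnS ltnS leq_addr.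
have meet X : X \in [set X in A | G \subset X] -> X :&: Y != set0.
  by rewrite inE => /andP[XA _]; apply: AB.
apply: leq_trans (card_leq_sdeg meet) _.
rewrite expnS -mulnA -[X in X * _](Br Y YB) -sum_nat_const.
apply: leq_sum => v vY; have vG : v \notin G by rewrite (disjointFr dYG).
have cvG : #|v |: G| = #|G|.+1 by rewrite cardsU1 vG.
rewrite addnS -addSn -cvG.
apply: leq_trans (IHm (v |: G) _).
  apply/subset_leq_card/subsetP => X.
  by rewrite !inE subUset sub1set -andbA => /and3P[-> -> ->].
move=> G' sG' cG'; apply: noT; first by apply: subset_trans sG'; apply: subsetUr.
by rewrite addnS -addSn -cvG.
Qed.

Definition transversal_of H G := [forall (X | X \in H), X :&: G != set0].

Lemma not_transversal H G : ~~ transversal_of H G ->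
  exists2 X, X \in H & [disjoint X & G].
Proof.
rewrite negb_forall => /existsP[X]; rewrite negb_imply negbK => /andP[XH XG].
by exists X => //; rewrite -setI_eq0.
Qed.

Lemma min_transversal r H : 1 <= r -> uniform r H -> H != set0 ->
  exists G, [/\ transversal_of H G, 1 <= #|G| &
                forall G', transversal_of H G' -> #|G| <= #|G'|].
Proof.
move=> r1 Hr /set0Pn[X0 X0H].
have tT : transversal_of H [set: 'I_n].
  by apply/forall_inP => X XH; rewrite setIT -card_gt0 (Hr X XH).
case: (arg_minnP (fun G => #|G|) tT) => G tG minG; exists G; split=> //.
rewrite card_gt0; apply/eqP => G0; move/forall_inP: tG => /(_ X0 X0H).
by rewrite G0 setI0 eqxx.
Qed.

(** Branching starts from each single vertex of [GA] and runs for |GB| - 1 steps: all sets met on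
    the way are smaller than [GB], hence no transversals of [B]. *)
Lemma branching_card r A B (GA GB : {set 'I_n}) : uniform r A -> uniform r B ->
    cross_intersecting A B -> transversal_of A GA -> 1 <= #|GB| ->
    (forall G', transversal_of B G' -> #|GB| <= #|G'|) ->
  #|A| <= #|GA| * (r ^ #|GB|.-1 * nsup n r #|GB|).
Proof.
move=> Ar Br AB /forall_inP tA GB1 minB.
apply: leq_trans (card_leq_sdeg tA) _; rewrite -sum_nat_const.
apply: leq_sum => v _.
have cGB : #|[set v]| + #|GB|.-1 = #|GB| by rewrite cards1 add1n prednK.
rewrite -[X in nsup _ _ X]cGB.
have -> : vdeg A v = #|[set X in A | [set v] \subset X]|.
  by apply: eq_card => X; rewrite !inE sub1set.
apply: (branching Ar Br AB) => G' _; rewrite cGB => ltG'.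
by apply: not_transversal; apply/negP => /minB; rewrite leqNgt ltG'.
Qed.

(** One branching step from {x}: the only set to avoid is {x} itself, and [Y] does so. *)
Lemma star_card r A B x Y : uniform r A -> uniform r B ->
    cross_intersecting A B -> (forall X, X \in A -> x \in X) ->
    Y \in B -> x \notin Y ->
  #|A| <= r * nsup n r 2.
Proof.
move=> Ar Br AB Ax YB xY.
have -> : A = [set X in A | [set x] \subset X].
  apply/setP => X; rewrite inE sub1set; case XA: (X \in A) => //=.
  by rewrite Ax.
have <- : #|[set x]| + 1 = 2 by rewrite cards1.
rewrite -[X in X * _]expn1.
apply: (branching Ar Br AB) => G' sG'; rewrite cards1 addn1 ltnS => cG'.
have <- : [set x] = G' by apply/eqP; rewrite eqEcard sG' cards1.
by exists Y => //; rewrite disjoint_sym disjoints1.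
Qed.

(** An edge through a vertex v of [S] also contains x, which differs from v, so each degree counts
    supersets of a pair. *)
Lemma star_sdeg r H x S : uniform r H -> (forall X, X \in H -> x \in X) ->
  #|S| = r -> x \notin S -> sdeg H S <= r * nsup n r 2.
Proof.
move=> Hr Hx Sr xS; rewrite /sdeg -{1}Sr -sum_nat_const.
apply: leq_sum => v vS.
have xv : x != v by apply: contraNneq xS => ->.
have <- : #|[set x; v]| = 2 by rewrite cards2 xv.
apply: leq_trans (card_supersets r _).
apply/subset_leq_card/subsetP => X; rewrite !inE => /andP[XH vX].
by rewrite (Hr X XH) eqxx subUset !sub1set vX Hx.
Qed.

(** * Non-edges and the Ore-degree *)

Lemma exists_disjoint r X : r + #|X| <= n ->
  exists2 S : {set 'I_n}, #|S| = r & [disjoint S & X].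
Proof.
move=> le_n; have : 0 < #|[set S : {set 'I_n} | S \subset ~: X & #|S| == r]|.
  by rewrite cards_draws bin_gt0 cardsCs setCK card_ord leq_subRL //; lia.
rewrite card_gt0 => /set0Pn[S]; rewrite inE => /andP[SX /eqP Sr].
by exists S => //; rewrite disjoints_subset.
Qed.

(** An [r]-set disjoint from a member of [B] cannot lie in [A]; this keeps the Ore-degree of [A]
    finite. *)
Lemma exists_nonedge r A B : 1 <= r -> r + r <= n -> uniform r B ->
  cross_intersecting A B -> B != set0 ->
  exists S, (#|S| == r) && (S \notin A).
Proof.
move=> r1 rn Br AB /set0Pn[Y YB].
have [|S Sr dSY] := @exists_disjoint r Y; first by rewrite (Br Y YB).
exists S; rewrite Sr eqxx /=; apply/negP => SA.
by have := AB S Y SA YB; rewrite setI_eq0 dSY.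
Qed.

Lemma ore_degreeP (r : nat) H : (exists S, (#|S| == r) && (S \notin H)) ->
  exists2 S : {set 'I_n}, (#|S| == r) && (S \notin H) &
    ore_degree r H = ((sdeg H S)%:Z%:E)%E /\
    (forall S', #|S'| = r -> S' \notin H -> sdeg H S <= sdeg H S').
Proof.
case=> S0 S0P.
pose P (S : {set 'I_n}) := (#|S| == r) && (S \notin H).
case: (@arg_minnP _ S0 P (sdeg H) S0P) => S PS minS; exists S => //.
split; last by move=> S' S'r S'H; apply: minS; rewrite /P S'r eqxx.
apply/eqP; rewrite eq_le; apply/andP; split.
  exact: (bigmin_le_cond +oo%E (fun S => (sdeg H S)%:Z%:E)%E PS).
rewrite /ore_degree; apply: le_bigmin; first exact: leey.
by move=> S' PS'; rewrite lee_fin lez_nat; apply: minS.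
Qed.

Lemma ore_degree_set0 r : r <= n -> ore_degree r (set0 : {set {set 'I_n}}) = 0%E.
Proof.
move=> rn.
have [|S _ [-> _]] := @ore_degreeP r set0.
  have [|S Sr _] := @exists_disjoint r set0; first by rewrite cards0 addn0.
  by exists S; rewrite Sr eqxx inE.
by rewrite sdegE big_set0.
Qed.

Lemma min_sdeg_mul r A B a b : 1 <= r -> 4 * r ^ 2 <= n ->
    uniform r A -> uniform r B -> cross_intersecting A B ->
    A != set0 -> B != set0 ->
    (forall S, #|S| = r -> S \notin A -> a <= sdeg A S) ->
    (forall S, #|S| = r -> S \notin B -> b <= sdeg B S) ->
  a * b <= r ^ 2 * nsup n r 2 ^ 2.
Proof.
move=> r1 hn Ar Br AB A0 B0 minA minB.
have BA : cross_intersecting B A by move=> X Y XB YA; rewrite setIC; apply: AB.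
have rn : r + r <= n by nia.
have n2 : 0 < n ^ 2 by nia.
have hA := min_sdeg_leq_card r1 Ar (exists_nonedge r1 rn Br AB B0) minA.
have hB := min_sdeg_leq_card r1 Br (exists_nonedge r1 rn Ar BA A0) minB.
(* By [hA] and [hB], n^2 a b <= r^4 |A| |B|, so the first alternative suffices; the second is a
   common centre. *)
suff [|[x [Ax Bx]]] : r ^ 2 * (#|A| * #|B|) <= n ^ 2 * nsup n r 2 ^ 2 \/
    exists x, (forall X, X \in A -> x \in X) /\ (forall X, X \in B -> x \in X).
- move/(leq_mul (leqnn (r ^ 2))) => hAB; rewrite -(leq_pmul2l n2).
  have := leq_mul hA hB; rewrite -!mulnn in hAB *; nia.
- have [|S Sr] := @exists_disjoint r [set x].
    by rewrite cards1; lia.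
  rewrite disjoint_sym disjoints1 => xS.
  have SA : S \notin A by apply: contra xS => /Ax.
  have SB : S \notin B by apply: contra xS => /Bx.
  rewrite -expnMn -mulnn; apply: leq_mul.
    by apply: leq_trans (minA S Sr SA) _; apply: (star_sdeg Ar Ax).
  by apply: leq_trans (minB S Sr SB) _; apply: (star_sdeg Br Bx).
have [GA [tA GA1 mA]] := min_transversal r1 Ar A0.
have [GB [tB GB1 mB]] := min_transversal r1 Br B0.
have cA := branching_card Ar Br AB tA GB1 mB.
have cB := branching_card Br Ar BA tB GA1 mA.
have [st|st] := ltnP 2 (#|GA| + #|GB|).
  left; apply: leq_trans (branch_mul_leq r1 hn GA1 GB1 st).
  rewrite leq_mul2l; apply/orP; right; apply: leq_trans (leq_mul cA cB) _.
  rewrite /branch; move: (r ^ _) (r ^ _) (nsup _ _ _) (nsup _ _ _) => p q u v.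
  lia.
(* Now y is a centre of [A] and x one of [B]. If neither is common, each family has a member missing
   the other's centre, and [star_card] bounds both. *)
have /eqP/cards1P[y GAy] : #|GA| = 1 by lia.
have /eqP/cards1P[x GBx] : #|GB| = 1 by lia.
have Ay X : X \in A -> y \in X.
  by move/(forall_inP tA X); rewrite GAy setI_eq0 disjoint_sym disjoints1 negbK.
have Bx X : X \in B -> x \in X.
  by move/(forall_inP tB X); rewrite GBx setI_eq0 disjoint_sym disjoints1 negbK.
have [tBy|/not_transversal[Y YB]] := boolP (transversal_of B [set y]).
  right; exists y; split=> // X /(forall_inP tBy X).
  by rewrite setI_eq0 disjoint_sym disjoints1 negbK.
rewrite disjoint_sym disjoints1 => yY.
have [tAx|/not_transversal[Z ZA]] := boolP (transversal_of A [set x]).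
  right; exists x; split=> // X /(forall_inP tAx X).
  by rewrite setI_eq0 disjoint_sym disjoints1 negbK.
rewrite disjoint_sym disjoints1 => xZ; left.
have := leq_mul (star_card Ar Br AB Ay YB yY) (star_card Br Ar BA Bx ZA xZ).
move/(leq_mul (leqnn (r ^ 2))) => /leq_trans; apply.
(* What remains is r^4 <= n^2, from r^2 <= n. *)
rewrite mulnn expnMn mulnA leq_mul2r; apply/orP; right.
by rewrite -expnMn leq_sqr mulnn; lia.
Qed.

End Hypergraphs.

Theorem theorem1p10 (r n : nat) (hr : (1 <= r)%N) (hn : (4 * r ^ 2 <= n)%N)
    (A B : {set {set 'I_n}}) (hA : uniform r A) (hB : uniform r B)
    (hAB : cross_intersecting A B) :
  (ore_degree r A * ore_degree r B
     <= ((r ^ 2 * binz (n - 2) (r%:Z - 2%:Z)%R ^ 2)%N%:Z)%:E)%E.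
Proof.
have rn : r + r <= n by nia.
(* An empty family has Ore-degree 0; the product is then 0 even if the other factor is +oo. *)
have [A0|A0] := eqVneq A set0.
  by rewrite A0 ore_degree_set0 ?mul0e ?lee_fin //; lia.
have [B0|B0] := eqVneq B set0.
  by rewrite B0 ore_degree_set0 ?mule0 ?lee_fin //; lia.
have hBA : cross_intersecting B A by move=> X Y XB YA; rewrite setIC; apply: hAB.
have [S _ [-> minA]] := ore_degreeP (exists_nonedge hr rn hB hAB B0).
have [T _ [-> minB]] := ore_degreeP (exists_nonedge hr rn hA hBA A0).
rewrite -EFinM lee_fin -PoszM lez_nat binz_nsup //.
exact: min_sdeg_mul hr hn hA hB hAB A0 B0 minA minB.
Qed.
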